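(* The calculus RD is cut-free complete for serial models: for every hypersequent $H$, if no model based on a serial frame is a counter-example to $H$, then $H$ has a derivation in RD that does not use the Cut rule.
   Context: **Language.** Modal formulas are built from propositional variables by $\lnot,\land,\Box$. A frame is $\langle W,R\rangle$ with $W\neq\emptyset$, $R\subseteq W\times W$; it is serial iff for every $w\in W$ there is $v\in W$ with $wRv$. A model $\mathfrak M=\langle W,R,V\rangle$ adds a valuation, and truth $\mathfrak M,w\models\varphi$ is the usual Kripke truth definition ($\Box\varphi$ is true at $w$ iff $\varphi$ is true at every $v$ with $wRv$). **Hypersequents.** A sequent is an expression $\Gamma\Rightarrow\Delta$ with $\Gamma,\Delta$ finite sets of formulas (written as comma-separated lists; $\varphi,\Gamma$ means $\{\varphi\}\cup\Gamma$, and $\varphi\in\Gamma$ is allowed). A hypersequent is a finite nonempty sequence of sequents $S_1\;/\!/\;\dots\;/\!/\; S_n$ (order and multiplicity matter). **Semantics.** $\mathfrak M$ is a countermodel to $\Gamma\Rightarrow\Delta$ at $w$ iff $\mathfrak M,w\models\varphi$ for all $\varphi\in\Gamma$ and $\mathfrak M,w\not\models\psi$ for all $\psi\in\Delta$. $\mathfrak M$ is a counter-example to $\Gamma_1\Rightarrow\Delta_1\;/\!/\;\dots\;/\!/\;\Gamma_n\Rightarrow\Delta_n$ iff there are worlds $w_1,\dots,w_n$ with $w_iRw_{i+1}$ for $1\le i<n$ such that $\mathfrak M$ is a countermodel to $\Gamma_i\Rightarrow\Delta_i$ at $w_i$ for every $i$. **The calculus RK.** Derivations are finite trees of hypersequents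 whose leaves are axioms $\varphi\Rightarrow\varphi$ (one-component hypersequents) and which are built by the following rules. Here $G,H$ are possibly empty sequences of sequents unless otherwise said; ''premise(s) / conclusion''. - WL: $G\;/\!/\;\Gamma\Rightarrow\Delta\;/\!/\; H$ / $G\;/\!/\;\varphi,\Gamma\Rightarrow\Delta\;/\!/\; H$. - WR: $G\;/\!/\;\Gamma\Rightarrow\Delta\;/\!/\; H$ / $G\;/\!/\;\Gamma\Rightarrow\Delta,\varphi\;/\!/\; H$. - Cut: $G\;/\!/\;\Gamma\Rightarrow\Delta,\varphi\;/\!/\; H$ and $G\;/\!/\;\varphi,\Lambda\Rightarrow\Theta\;/\!/\; H$ / $G\;/\!/\;\Gamma,\Lambda\Rightarrow\Delta,\Theta\;/\!/\; H$. - EWR: $G$ / $G\;/\!/\;\ \Rightarrow\ $ ($G$ a hypersequent; an empty sequent is appended on the right). - EWL: $G$ / $\ \Rightarrow\ \;/\!/\; G$ ($G$ a hypersequent; an empty sequent is prepended on the left). - $\lnot$L: $G\;/\!/\;\Gamma\Rightarrow\Delta,\varphi\;/\!/\; H$ / $G\;/\!/\;\lnot\varphi,\Gamma\Rightarrow\Delta\;/\!/\; H$. - $\lnot$R: $G\;/\!/\;\varphi,\Gamma\Rightarrow\Delta\;/\!/\; H$ / $G\;/\!/\;\Gamma\Rightarrow\Delta,\lnot\varphi\;/\!/\; H$. - $\land$L$_1$: $G\;/\!/\;\varphi,\Gamma\Rightarrow\Delta\;/\!/\; H$ / $G\;/\!/\;\varphi\land\psi,\Gamma\Rightarrow\Delta\;/\!/\;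 H$. - $\land$L$_2$: $G\;/\!/\;\psi,\Gamma\Rightarrow\Delta\;/\!/\; H$ / $G\;/\!/\;\varphi\land\psi,\Gamma\Rightarrow\Delta\;/\!/\; H$. - $\land$R: $G\;/\!/\;\Gamma\Rightarrow\Delta,\varphi\;/\!/\; H$ and $G\;/\!/\;\Gamma\Rightarrow\Delta,\psi\;/\!/\; H$ / $G\;/\!/\;\Gamma\Rightarrow\Delta,\varphi\land\psi\;/\!/\; H$. - $\Box$L: $G\;/\!/\;\Gamma\Rightarrow\Delta\;/\!/\;\varphi,\Lambda\Rightarrow\Theta\;/\!/\; H$ / $G\;/\!/\;\Box\varphi,\Gamma\Rightarrow\Delta\;/\!/\;\Lambda\Rightarrow\Theta\;/\!/\; H$. - $\Box$R: $H\;/\!/\;\Gamma\Rightarrow\Delta\;/\!/\;\ \Rightarrow\varphi$ / $H\;/\!/\;\Gamma\Rightarrow\Delta,\Box\varphi$ (the active components are rightmost). **The calculus RD** is RK together with the rule Drop: $G\;/\!/\;\ \Rightarrow\ $ / $G$ ($G$ a hypersequent; an empty rightmost sequent is deleted). *)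

(* Defs.v *)
(* Mathematical Components, with finite sets from finmap. *)
From HB Require Import structures.
From mathcomp Require Import all_boot.
From mathcomp Require Import finmap.

Set Implicit Arguments.
Unset Strict Implicit.
Unset Printing Implicit Defensive.

Local Open Scope fset_scope.

Inductive form (P : Type) : Type :=
| Var of P
| Neg of form P
| And of form P & form P
| Box of form P.

Arguments Var {P} _.
Arguments Neg {P} _.
Arguments And {P} _ _.
Arguments Box {P} _.

(* Formulas are encoded as labelled trees only to obtain the choiceType
   structure that {fset form P} requires. *)
Section FormChoice.
Variable P : choiceType.

Fixpoint tree_of_form (phi : form P) : GenTree.tree P :=
  match phi with
  | Var p => GenTree.Leaf p
  | Neg phi1 => GenTree.Node 0 [:: tree_of_form phi1]
  | And phi1 phi2 => GenTree.Node 1 [:: tree_of_form phi1; tree_of_form phi2]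
  | Box phi1 => GenTree.Node 2 [:: tree_of_form phi1]
  end.

Fixpoint form_of_tree (t : GenTree.tree P) : option (form P) :=
  match t with
  | GenTree.Leaf p => Some (Var p)
  | GenTree.Node 0 [:: t1] => omap Neg (form_of_tree t1)
  | GenTree.Node 1 [:: t1; t2] =>
      obind (fun phi1 => omap (And phi1) (form_of_tree t2)) (form_of_tree t1)
  | GenTree.Node 2 [:: t1] => omap Box (form_of_tree t1)
  | _ => None
  end.

Lemma tree_of_formK : pcancel tree_of_form form_of_tree.
Proof. by elim=> [p|phi /= ->|phi /= -> psi /= ->|phi /= ->]. Qed.

HB.instance Definition _ := Choice.copy (form P) (pcan_type tree_of_formK).

End FormChoice.

Record model (P : Type) := Model {
  world : Type;
  world_inhabited : inhabited world;
  acc : world -> world -> Prop;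
  val : P -> world -> Prop
}.

Definition serial (P : Type) (M : model P) : Prop :=
  forall w : world M, exists v : world M, acc w v.

Fixpoint sat (P : Type) (M : model P) (w : world M) (phi : form P) : Prop :=
  match phi with
  | Var p => val p w
  | Neg phi1 => ~ sat w phi1
  | And phi1 phi2 => sat w phi1 /\ sat w phi2
  | Box phi1 => forall v : world M, acc w v -> sat v phi1
  end.

Record sequent (P : choiceType) := Sequent {
  ant : {fset form P};
  suc : {fset form P}
}.

Notation "Gamma ==>> Delta" := (Sequent Gamma%fset Delta%fset)
  (at level 55, no associativity).

(* The type also contains the empty sequence, which is not a hypersequent:
   non-emptiness is required separately wherever it is not automatic. *)
Notation hseq P := (seq (sequent P)).

Definition countermodel (P : choiceType) (M : model P) (w : world M)
    (S : sequent P) : Prop :=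
  (forall phi, phi \in ant S -> sat w phi) /\
  (forall psi, psi \in suc S -> ~ sat w psi).

Definition counterexample (P : choiceType) (M : model P) (H : hseq P) : Prop :=
  exists w : 'I_(size H) -> world M,
    (forall i j : 'I_(size H), j = i.+1 :> nat -> acc (w i) (w j)) /\
    (forall i : 'I_(size H), countermodel (w i) (tnth (in_tuple H) i)).

Inductive calculus := RK | RD.

(* phi |` Gamma is {phi} U Gamma, where phi may already be in Gamma, so
   contraction is built into the rules. *)
Inductive derivation (P : choiceType) (C : calculus) : hseq P -> Type :=
| Ax phi :
    derivation C [:: [fset phi] ==>> [fset phi]]
| WL G H phi Gamma Delta :
    derivation C (G ++ (Gamma ==>> Delta) :: H) ->
    derivation C (G ++ (phi |` Gamma ==>> Delta) :: H)
| WR G H phi Gamma Delta :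
    derivation C (G ++ (Gamma ==>> Delta) :: H) ->
    derivation C (G ++ (Gamma ==>> phi |` Delta) :: H)
| Cut G H phi Gamma Delta Lambda Theta :
    derivation C (G ++ (Gamma ==>> phi |` Delta) :: H) ->
    derivation C (G ++ (phi |` Lambda ==>> Theta) :: H) ->
    derivation C (G ++ (Gamma `|` Lambda ==>> Delta `|` Theta) :: H)
| EWR G :
    G <> [::] ->
    derivation C G ->
    derivation C (G ++ [:: fset0 ==>> fset0])
| EWL G :
    G <> [::] ->
    derivation C G ->
    derivation C ((fset0 ==>> fset0) :: G)
| NegL G H phi Gamma Delta :
    derivation C (G ++ (Gamma ==>> phi |` Delta) :: H) ->
    derivation C (G ++ (Neg phi |` Gamma ==>> Delta) :: H)
| NegR G H phi Gamma Delta :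
    derivation C (G ++ (phi |` Gamma ==>> Delta) :: H) ->
    derivation C (G ++ (Gamma ==>> Neg phi |` Delta) :: H)
| AndL1 G H phi psi Gamma Delta :
    derivation C (G ++ (phi |` Gamma ==>> Delta) :: H) ->
    derivation C (G ++ (And phi psi |` Gamma ==>> Delta) :: H)
| AndL2 G H phi psi Gamma Delta :
    derivation C (G ++ (psi |` Gamma ==>> Delta) :: H) ->
    derivation C (G ++ (And phi psi |` Gamma ==>> Delta) :: H)
| AndR G H phi psi Gamma Delta :
    derivation C (G ++ (Gamma ==>> phi |` Delta) :: H) ->
    derivation C (G ++ (Gamma ==>> psi |` Delta) :: H) ->
    derivation C (G ++ (Gamma ==>> And phi psi |` Delta) :: H)
| BoxL G H phi Gamma Delta Lambda Theta :
    derivation C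
      (G ++ [:: Gamma ==>> Delta, phi |` Lambda ==>> Theta & H]) ->
    derivation C
      (G ++ [:: Box phi |` Gamma ==>> Delta, Lambda ==>> Theta & H])
| BoxR H phi Gamma Delta :
    derivation C (H ++ [:: Gamma ==>> Delta; fset0 ==>> [fset phi]]) ->
    derivation C (H ++ [:: Gamma ==>> Box phi |` Delta])
| Drop G :
    C = RD ->
    G <> [::] ->
    derivation C (G ++ [:: fset0 ==>> fset0]) ->
    derivation C G.

Fixpoint cut_free (P : choiceType) (C : calculus) (H : hseq P)
    (d : derivation C H) : Prop :=
  match d with
  | Ax _ => True
  | Cut _ _ _ _ _ _ _ _ _ => False
  | AndR _ _ _ _ _ _ d1 d2 => cut_free d1 /\ cut_free d2
  | WL _ _ _ _ _ d1 | WR _ _ _ _ _ d1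
  | EWR _ _ d1 | EWL _ _ d1
  | NegL _ _ _ _ _ d1 | NegR _ _ _ _ _ d1
  | AndL1 _ _ _ _ _ _ d1 | AndL2 _ _ _ _ _ _ d1
  | BoxL _ _ _ _ _ _ _ d1 | BoxR _ _ _ _ d1
  | Drop _ _ _ d1 => cut_free d1
  end.

(* Main.v *)
Require Import Defs.
From Stdlib Require Import Classical.
From mathcomp Require Import all_boot.
From mathcomp Require Import finmap.

Set Implicit Arguments.
Unset Strict Implicit.
Unset Printing Implicit Defensive.

(** A canonical model of saturated sequents that are underivable as one-component
    hypersequents.  Contraction being built in, each logical rule may keep its
    principal formula in the premise, so an underivable hypersequent can be
    saturated one component at a time, from left to right, without touching the
    components already treated.  [BoxR] supplies the successors refuting boxed
    formulas, and [Drop] makes the canonical model serial.  External weakening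
    turns every component of an underivable hypersequent into an underivable
    sequent, so the saturated components form a path in the canonical model. *)

Local Open Scope fset_scope.

Section CanonicalModel.

Variable P : choiceType.
Implicit Types (phi psi : form P) (Gamma Delta : {fset form P}).
Implicit Types (S T : sequent P) (G H : hseq P) (B : {fset form P}).

(** * Cut-free provability and admissible weakenings *)

Definition provable H := exists d : derivation RD H, cut_free d.

Definition subsequent S T := (ant S `<=` ant T) && (suc S `<=` suc T).

Lemma provable_wk G H S T :
  subsequent S T -> provable (G ++ S :: H) -> provable (G ++ T :: H).
Proof.
case: S T => [Gamma Delta] [Gamma' Delta'] /andP[/= sG sD] pr.
(* Stated with unions, the claim no longer depends on the inclusions, so the added formulas can be
   inserted one at a time by induction on [Gamma'], then on [Delta']. *)
have : provable (G ++ (Gamma `|` Gamma' ==>> Delta `|` Delta') :: H).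
  elim/finSet_rect: Gamma' {sG} => Gamma' IHG.
  case: (fset_0Vmem Gamma') => [->|[phi phiG]]; last first.
    have [d cf] := IHG _ (fproperD1 phiG).
    suff -> : Gamma `|` Gamma' = phi |` (Gamma `|` (Gamma' `\ phi)).
      by exists (WL phi d).
    by rewrite fsetUCA fsetD1K.
  rewrite fsetU0; elim/finSet_rect: Delta' {sD IHG} => Delta' IHD.
  case: (fset_0Vmem Delta') => [->|[phi phiD]]; first by rewrite fsetU0.
  have [d cf] := IHD _ (fproperD1 phiD).
  suff -> : Delta `|` Delta' = phi |` (Delta `|` (Delta' `\ phi)).
    by exists (WR phi d).
  by rewrite fsetUCA fsetD1K.
by rewrite (fsetUidPr _ _ sG) (fsetUidPr _ _ sD).
Qed.

Lemma subsequent_refl S : subsequent S S.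
Proof. by rewrite /subsequent !fsubset_refl. Qed.

Lemma subsequent_trans S T U :
  subsequent S T -> subsequent T U -> subsequent S U.
Proof.
case/andP=> sa ss /andP[ta ts].
by rewrite /subsequent (fsubset_trans sa ta) (fsubset_trans ss ts).
Qed.

Lemma empty_subsequent S : subsequent (fset0 ==>> fset0) S.
Proof. by rewrite /subsequent !fsub0set. Qed.

(** [EWR] appends an empty sequent, which internal weakening then fills up to the next component of
    [H]. *)
Lemma provable_catr G H : G <> [::] -> provable G -> provable (G ++ H).
Proof.
elim: H G => [|S H IH] G G0 [d cf]; first by rewrite cats0; exists d.
rewrite -cat_rcons; apply: IH; first by case: G {d cf G0}.
rewrite -cats1; apply: provable_wk (empty_subsequent S) _.
by exists (EWR G0 d).
Qed.

Lemma provable_catl G H : H <> [::] -> provable H -> provable (G ++ H).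
Proof.
move=> H0 pr; elim: G => [//|S G [d cf]].
apply: (@provable_wk [::] _ _ _ (empty_subsequent S)).
have GH0 : G ++ H <> [::] by case: G {d cf}.
by exists (EWL GH0 d).
Qed.

Lemma provable_component G H S : provable [:: S] -> provable (G ++ S :: H).
Proof. by move=> pr; apply: provable_catl => //; apply: (@provable_catr [:: S]). Qed.

Lemma provable_axiom G H S phi :
  phi \in ant S -> phi \in suc S -> provable (G ++ S :: H).
Proof.
move=> pa ps; apply/provable_component/(@provable_wk [::] [::]); last first.
  by exists (Ax RD phi).
by rewrite /subsequent /= !fsub1set pa ps.
Qed.

(** * Saturation of one component inside a fixed context *)

Record saturated S : Prop := Saturated {
  sat_negl phi : Neg phi \in ant S -> phi \in suc S;
  sat_negr phi : Neg phi \in suc S -> phi \in ant S;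
  sat_andl phi psi : And phi psi \in ant S -> phi \in ant S /\ psi \in ant S;
  sat_andr phi psi : And phi psi \in suc S -> phi \in suc S \/ psi \in suc S
}.

(** The canonical accessibility relation. Boxes link neighbouring components, so they are treated
    here and not in [saturated]. *)
Definition box_sub S T := forall phi, Box phi \in ant S -> phi \in ant T.

Fixpoint subforms phi : seq (form P) :=
  phi :: match phi with
         | Var _ => [::]
         | Neg phi1 | Box phi1 => subforms phi1
         | And phi1 phi2 => subforms phi1 ++ subforms phi2
         end.

Lemma mem_subforms phi : phi \in subforms phi.
Proof. by case: phi => *; rewrite /= inE eqxx. Qed.

Definition subform_closed B := forall phi, phi \in B -> {subset subforms phi <= B}.

Lemma subforms_trans phi psi :
  psi \in subforms phi -> {subset subforms psi <= subforms phi}.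
Proof.
elim: phi => [p|f IHf|f IHf g IHg|f IHf] /=; rewrite in_cons ?mem_cat.
- by rewrite orbF => /eqP ->.
- by case/predU1P=> [-> //|/IHf s] x /s; rewrite in_cons orbC => ->.
- case/or3P=> [/eqP -> //|/IHf s|/IHg s] x /s;
  by rewrite in_cons mem_cat => ->; rewrite ?orbT.
- by case/predU1P=> [-> //|/IHf s] x /s; rewrite in_cons orbC => ->.
Qed.

Lemma subform_closure B : exists2 B', subform_closed B' & B `<=` B'.
Proof.
exists [fset psi in flatten [seq subforms phi | phi <- B]] => [phi|].
  rewrite inE => /flatten_mapP[psi psiB phiS] x /(subforms_trans phiS) xS.
  by rewrite inE; apply/flatten_mapP; exists psi.
apply/fsubsetP=> phi phiB; rewrite inE; apply/flatten_mapP.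
by exists phi; rewrite ?mem_subforms.
Qed.

Definition over B S := (ant S `<=` B) && (suc S `<=` B).

(** Saturation is obtained from maximality among underivable choices for one component, with
    formulas drawn from a finite set [B]. *)
Definition maximal_in B G H S :=
  [/\ over B S, ~ provable (G ++ S :: H),
      forall phi, phi \in B -> phi \notin ant S ->
        provable (G ++ (phi |` ant S ==>> suc S) :: H)
    & forall phi, phi \in B -> phi \notin suc S ->
        provable (G ++ (ant S ==>> phi |` suc S) :: H)].

Lemma card_fsetD_add B Gamma phi : phi \in B -> phi \notin Gamma ->
  #|` B `\` Gamma| = #|` B `\` (phi |` Gamma)|.+1.
Proof.
move=> phiB phiG; rewrite (cardfsD1 phi) inE phiG phiB /= add1n.
by rewrite fsetDDl fsetUC.
Qed.

(** Induction on the number of formulas of [B] missing from the two sides of [S]: if [S] is not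
    maximal, some missing formula can be added while preserving underivability. *)
Lemma maximal_extension B G H S :
  over B S -> ~ provable (G ++ S :: H) ->
  exists2 T, subsequent S T & maximal_in B G H T.
Proof.
have [n] := ubnP (#|` B `\` ant S| + #|` B `\` suc S|)%N.
elim: n S => // n IH S ltn /[dup] ovS /andP[aB sB] npr.
have step T : subsequent S T -> over B T -> ~ provable (G ++ T :: H) ->
    (#|` B `\` ant S| + #|` B `\` suc S| =
      (#|` B `\` ant T| + #|` B `\` suc T|).+1)%N ->
    exists2 U, subsequent S U & maximal_in B G H U.
  move=> sST ovT nprT eqn; have [||//|U sTU maxU] := IH T.
  - by rewrite -ltnS -eqn.
  - by [].
  - by exists U => //; apply: subsequent_trans sST sTU.
case: (classic (forall phi, phi \in B -> phi \notin ant S ->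
  provable (G ++ (phi |` ant S ==>> suc S) :: H))) => [maxa|]; last first.
  case/not_all_ex_not=> phi h; have [phiB {}h] := imply_to_and _ _ h.
  have [phiS nprS] := imply_to_and _ _ h.
  apply: step nprS _.
  - by rewrite /subsequent /= fsubsetUr fsubset_refl.
  - by rewrite /over /= fsubUset fsub1set phiB aB.
  - by rewrite (card_fsetD_add phiB phiS).
case: (classic (forall phi, phi \in B -> phi \notin suc S ->
  provable (G ++ (ant S ==>> phi |` suc S) :: H))) => [maxs|]; last first.
  case/not_all_ex_not=> phi h; have [phiB {}h] := imply_to_and _ _ h.
  have [phiS nprS] := imply_to_and _ _ h.
  apply: step nprS _.
  - by rewrite /subsequent /= fsubsetUr fsubset_refl.
  - by rewrite /over /= fsubUset fsub1set phiB aB.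
  - by rewrite (card_fsetD_add phiB phiS) addnS.
by exists S; first exact: subsequent_refl.
Qed.

(** If a formula demanded by a clause were missing, maximality would make its addition derivable.
    The matching logical rule would then derive the original hypersequent, since its principal
    formula is already in [S]. *)
Lemma maximal_saturated B G H S :
  subform_closed B -> maximal_in B G H S -> saturated S.
Proof.
case: S => Gamma Delta clB [/andP[/= /fsubsetP aB /fsubsetP sB] npr maxa maxs].
split=> /= [phi neg|phi neg|phi psi conj|phi psi conj].
- apply/negPn/negP=> /maxs[|d cf].
    by apply: clB (aB _ neg) _ _; rewrite /= in_cons mem_subforms orbT.
  by apply: npr; rewrite -(mem_fset1U neg); exists (NegL d).
- apply/negPn/negP=> /maxa[|d cf].
    by apply: clB (sB _ neg) _ _; rewrite /= in_cons mem_subforms orbT.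
  by apply: npr; rewrite -(mem_fset1U neg); exists (NegR d).
- split; apply/negPn/negP=> /maxa[|d cf].
  + by apply: clB (aB _ conj) _ _; rewrite /= in_cons mem_cat mem_subforms orbT.
  + by apply: npr; rewrite -(mem_fset1U conj); exists (AndL1 psi d).
  + by apply: clB (aB _ conj) _ _; rewrite /= in_cons mem_cat mem_subforms !orbT.
  + by apply: npr; rewrite -(mem_fset1U conj); exists (AndL2 phi d).
- apply/orP/negPn/negP; rewrite negb_or => /andP[/maxs pr1 /maxs pr2].
  have [|d1 cf1] := pr1.
    by apply: clB (sB _ conj) _ _; rewrite /= in_cons mem_cat mem_subforms orbT.
  have [|d2 cf2] := pr2.
    by apply: clB (sB _ conj) _ _; rewrite /= in_cons mem_cat mem_subforms !orbT.
  by apply: npr; rewrite -(mem_fset1U conj); exists (AndR d1 d2).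
Qed.

(** The same argument with [BoxL]: the boxed formula already lies in [S], so the conclusion of the
    rule leaves the left neighbour unchanged. *)
Lemma maximal_box_sub B G H S T :
  subform_closed B -> ant S `<=` B -> maximal_in B (rcons G S) H T ->
  box_sub S T.
Proof.
case: S T => Gamma Delta [Lambda Theta] clB /fsubsetP aB [/= _ npr maxa _].
move=> phi /= box; apply/negPn/negP=> /maxa[|d cf].
  by apply: clB (aB _ box) _ _; rewrite /= in_cons mem_subforms orbT.
apply: npr; rewrite cat_rcons in d cf.
by rewrite cat_rcons -(mem_fset1U box); exists (BoxL d).
Qed.

Lemma saturation G H S : ~ provable (G ++ S :: H) ->
  exists T, [/\ subsequent S T, ~ provable (G ++ T :: H), saturated T
              & forall G' S', G = rcons G' S' -> box_sub S' T].
Proof.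
(* The bound must also contain the subformulas of the left neighbour's antecedent, so that unboxed
   formulas fall under maximality. For empty [G] the default [S] is harmless, as the box clause is
   then vacuous. *)
move=> npr; pose L := last S G.
have [B clB] := subform_closure (ant S `|` suc S `|` ant L).
rewrite !fsubUset => /andP[ovS aL].
have [T sST maxT] := maximal_extension ovS npr; exists T; split=> //.
- by case: maxT.
- exact: maximal_saturated clB maxT.
move=> G' S' eqG; rewrite /L eqG last_rcons in aL.
by rewrite eqG in maxT; apply: maximal_box_sub clB aL maxT.
Qed.

(** * The canonical model *)

Definition consistent S := ~ provable [:: S] /\ saturated S.

Lemma consistent_successor S T : ~ provable [:: S; T] ->
  exists U, [/\ consistent U, box_sub S U & subsequent T U].
Proof.
move=> /(@saturation [:: S] [::])[U [sTU npr satU box]].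
exists U; split=> //; last exact: (box [::]).
by split=> // pr; apply: npr; apply: (@provable_component [:: S]).
Qed.

Definition canonical_world := {S | consistent S}.

(** The parameter [w] supplies the proof that the set of worlds is inhabited. *)
Definition canonical_model (w : canonical_world) : model P :=
  @Model P canonical_world (inhabits w)
    (fun u v => box_sub (sval u) (sval v)) (fun p u => Var p \in ant (sval u)).

Lemma canonical_serial w : serial (canonical_model w).
Proof.
move=> [S conS]; have [|T [conT box _]] := @consistent_successor S (fset0 ==>> fset0).
  (* A derivation of [S] followed by the empty sequent would yield one of [S] alone by [Drop]. *)
  move=> [d cf]; case: conS => npr _; apply: npr.
  have S0 : [:: S] <> [::] by [].
  by exists (@Drop _ RD [:: S] erefl S0 d).
by exists (exist _ T conT).
Qed.

(** The truth lemma. Both sides are proved in one induction because negation exchanges them. *)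
Lemma canonical_countermodel w (u : world (canonical_model w)) :
  countermodel u (sval u).
Proof.
suff truth phi : forall v : world (canonical_model w),
    (phi \in ant (sval v) -> sat v phi) /\ (phi \in suc (sval v) -> ~ sat v phi).
  by split=> phi; case: (truth phi u).
elim: phi => [p|f IHf|f IHf g IHg|f IHf] v /=.
- split=> // ps pa; case: (svalP v) => npr _; apply: npr.
  exact: (@provable_axiom [::] [::] _ (Var p)).
- have [_ satv] := svalP v; have [tf ff] := IHf v.
  split=> [neg|neg nsat]; first exact/ff/(sat_negl satv).
  exact/nsat/tf/(sat_negr satv).
- have [_ satv] := svalP v; have [tf ff] := IHf v; have [tg fg] := IHg v.
  split=> [/(sat_andl satv)[/tf ? /tg]|] //.
  by case/(sat_andr satv) => [/ff|/fg] ? [].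
- split=> [box u' /(_ _ box)|]; first by case: (IHf u').
  case: v => [[Gamma Delta] [npr satv]] /= box.
  have [|T [conT boxT /andP[_]]] :=
      @consistent_successor (Gamma ==>> Delta) (fset0 ==>> [fset f]).
    (* [BoxR] with no further components would derive the world itself, which already has [Box f] in
       its succedent. *)
    move=> [d cf]; apply: npr; rewrite -(mem_fset1U box).
    by exists (@BoxR _ RD [::] f Gamma Delta d).
  rewrite fsub1set => fT sub.
  have [_ /(_ fT)] := IHf (exist _ T conT); apply.
  exact: sub.
Qed.

(** * Paths through the canonical model *)

Lemma countermodel_sub (M : model P) (w : world M) S T :
  subsequent S T -> countermodel w T -> countermodel w S.
Proof.
case/andP=> /fsubsetP sa /fsubsetP ss [ca cs].
by split=> phi; [move/sa/ca|move/ss/cs].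
Qed.

Lemma saturated_path H : ~ provable H ->
  exists s : hseq P, let S0 := fset0 ==>> fset0 in
  [/\ size s = size H, ~ provable s,
      forall i, (i < size H)%N -> saturated (nth S0 s i),
      forall i, (i < size H)%N -> subsequent (nth S0 H i) (nth S0 s i)
    & forall i, (i.+1 < size H)%N -> box_sub (nth S0 s i) (nth S0 s i.+1)].
Proof.
move=> npr; set S0 := fset0 ==>> fset0.
(* Invariant: the first [k] components are saturated and final, the others are still those of [H].
   Going left to right, no new box can later appear in a left neighbour. *)
suff inv k : (k <= size H)%N -> exists s : hseq P,
  [/\ size s = k, ~ provable (s ++ drop k H),
      forall i, (i < k)%N -> saturated (nth S0 s i),
      forall i, (i < k)%N -> subsequent (nth S0 H i) (nth S0 s i)
    & forall i, (i.+1 < k)%N -> box_sub (nth S0 s i) (nth S0 s i.+1)].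
  have [s [ss nprs sats subs boxs]] := inv _ (leqnn _).
  by exists s; split=> //; rewrite drop_size cats0 in nprs.
elim: k => [_|k IH ltk]; first by exists [::]; rewrite drop0; split.
have [s [ss nprs sats subs boxs]] := IH (ltnW ltk).
rewrite (drop_nth S0 ltk) in nprs.
have [T [sT nprT satT boxT]] := saturation nprs.
exists (rcons s T); split.
- by rewrite size_rcons ss.
- by rewrite cat_rcons.
- move=> i; rewrite ltnS leq_eqVlt => /predU1P[->|lti].
    by rewrite -ss nth_rcons ltnn eqxx.
  by rewrite nth_rcons ss lti; apply: sats.
- move=> i; rewrite ltnS leq_eqVlt => /predU1P[->|lti].
    by rewrite nth_rcons ss ltnn eqxx.
  by rewrite nth_rcons ss lti; apply: subs.
- move=> i; rewrite ltnS leq_eqVlt => /predU1P[eqi|lti].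
    rewrite !nth_rcons ss -eqi ltnn eqxx ltnSn.
    (* The only new link joins the last component of [s] to [T]; here [s] has size [i.+1], hence is
       nonempty. *)
    move: ss boxT; rewrite -eqi; case/lastP: s {nprs nprT sats subs boxs} => // s S.
    rewrite size_rcons => -[<-] /(_ _ _ erefl).
    by rewrite nth_rcons ltnn eqxx.
  by rewrite !nth_rcons ss lti ltnW //; apply: boxs.
Qed.

End CanonicalModel.

Theorem mainTheorem3 (P : choiceType) (H : seq (sequent P))
    (H_nonempty : H <> [::]) :
  ~ (exists M : model P, serial M /\ counterexample M H) ->
  exists d : derivation RD H, cut_free d.
Proof.
move=> nocex; apply: NNPP => /saturated_path[s [ss npr sats subs boxs]].
have con i : (i < size H)%N -> consistent (nth (fset0 ==>> fset0) s i).
  move=> lti; split; last exact: sats.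
  move=> pr; apply: npr; rewrite -ss in lti.
  rewrite -(cat_take_drop i s) (drop_nth (fset0 ==>> fset0) lti).
  exact: provable_component.
pose w (i : 'I_(size H)) : canonical_world P := exist _ _ (con _ (ltn_ord i)).
(* Nonemptiness of [H] provides a first component, whose world witnesses that the model is
   inhabited. *)
have H_gt0 : (0 < size H)%N by case: H H_nonempty {nocex ss npr sats subs boxs con w}.
apply: nocex; exists (canonical_model (w (Ordinal H_gt0))).
split; first exact: canonical_serial.
exists w; split=> [i j eqj|i].
  by rewrite /= eqj; apply: boxs; rewrite -eqj.
apply: countermodel_sub (canonical_countermodel (w i)).
by rewrite (tnth_nth (fset0 ==>> fset0)); apply: subs.
Qed.
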